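(* For each of the twelve six-dimensional real nilpotent Lie algebras $\mathfrak g_1,\mathfrak g_2,\dots,\mathfrak g_9,\mathfrak g_{19},\mathfrak g_{20},\mathfrak g_{22}$ listed in the context, and for each symplectic form $\omega$ listed there for that Lie algebra, there exists an almost complex structure $J$ on the Lie algebra which is compatible with $\omega$ and almost nilpotent, and whose associated metric $g(X,Y)=\omega(X,JY)$ is pseudo-Riemannian (indefinite). Thus each of the corresponding connected simply connected symplectic Lie groups carries a left-invariant almost pseudo-Kähler structure $(g,J,\omega)$.
   Context: An almost complex structure on a real Lie algebra $\mathfrak g$ is an endomorphism $J:\mathfrak g\to\mathfrak g$ with $J^2=-I$. A symplectic form on $\mathfrak g$ is a nondegenerate skew-symmetric bilinear form $\omega$ with $\omega([X,Y],Z)-\omega([X,Z],Y)+\omega([Y,Z],X)=0$ for all $X,Y,Z$. $J$ is compatible with $\omega$ if $\omega(JX,JY)=\omega(X,Y)$ for all $X,Y$; then $g(X,Y)=\omega(X,JY)$ is a nondegenerate symmetric bilinear form (the associated metric). A left-invariant almost pseudo-Kähler structure on a Lie group is given by such a triple $(g,J,\omega)$ on its Lie algebra. $J$ is called almost nilpotent (for $\dim\mathfrak g=2m$) if there is an increasing sequence of $J$-invariant ideals $\mathfrak b_1\subset\mathfrak b_2\subset\dots\subset\mathfrak b_m=\mathfrak g$ of dimensions $2,4,\dots,2m$. List (basis $e_1,\dots,e_6$, dual basis $e^1,\dots,e^6$, notation $e^{ij}=e^i\wedge e^j$; only nonzero brackets, up to skew-symmetry, are listed). $\mathfrak g_1$: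 $[e_1,e_2]=e_3$, $[e_1,e_3]=e_4$, $[e_1,e_4]=e_5$, $[e_1,e_5]=e_6$, $[e_2,e_3]=e_5$, $[e_2,e_4]=e_6$; $\omega=e^{16}+(1-\lambda)e^{25}+\lambda e^{34}$, $\lambda\in\mathbb R\setminus\{0,1\}$. $\mathfrak g_2$: $[e_1,e_2]=e_3$, $[e_1,e_3]=e_4$, $[e_1,e_4]=e_5$, $[e_1,e_5]=e_6$, $[e_2,e_3]=e_6$; $\omega=\lambda(e^{16}+e^{24}+e^{34}-e^{25})$, $\lambda\neq0$. $\mathfrak g_3$: $[e_1,e_2]=e_3$, $[e_1,e_3]=e_4$, $[e_1,e_4]=e_5$, $[e_1,e_5]=e_6$; $\omega=e^{16}-e^{25}+e^{34}$. $\mathfrak g_4$: $[e_1,e_2]=e_3$, $[e_1,e_3]=e_4$, $[e_1,e_4]=e_6$, $[e_2,e_3]=e_5$, $[e_2,e_5]=e_6$; $\omega=\lambda_1e^{14}+\lambda_2(e^{15}+e^{16}+e^{24}+e^{35})$, $\lambda_1,\lambda_2\in\mathbb R$, $\lambda_2\neq0$. $\mathfrak g_5$: $[e_1,e_2]=e_3$, $[e_1,e_3]=e_4$, $[e_1,e_4]=-e_6$, $[e_2,e_3]=e_5$, $[e_2,e_5]=e_6$; $\omega_1=\lambda_1e^{14}+\lambda_2(e^{15}+e^{16}+e^{24}+e^{35})$, $\lambda_1,\lambda_2\in\mathbb R$, $\lambda_2\ne0$; $\omega_2=\lambda(e^{16}-2e^{15}-2e^{24}+e^{26}+e^{34}+e^{35})$,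 $\lambda\neq0$; $\omega_3=\lambda(e^{14}-e^{15}+e^{16}-e^{24}+e^{25}+e^{26}+e^{34}+e^{35})$, $\lambda\ne0$; $\omega_4=\lambda(2e^{14}+e^{16}+2e^{25}+e^{26}+e^{34}+e^{35})$, $\lambda\neq0$. $\mathfrak g_6$: $[e_1,e_2]=e_3$, $[e_1,e_3]=e_4$, $[e_1,e_4]=e_5$, $[e_2,e_3]=e_6$; $\omega_1=e^{16}+e^{24}+e^{25}-e^{34}$, $\omega_2=-\omega_1$. $\mathfrak g_7$: $[e_1,e_2]=e_4$, $[e_1,e_4]=e_5$, $[e_1,e_5]=e_6$, $[e_2,e_3]=e_6$, $[e_2,e_4]=e_6$; $\omega_1=\lambda(e^{13}+e^{26}-e^{45})$, $\omega_2=\lambda(e^{16}+e^{25}-e^{34})$, $\lambda\ne0$. $\mathfrak g_8$: $[e_1,e_3]=e_4$, $[e_1,e_4]=e_5$, $[e_1,e_5]=e_6$, $[e_2,e_3]=e_5$, $[e_2,e_4]=e_6$; $\omega=e^{16}+e^{25}-e^{34}$. $\mathfrak g_9$: $[e_1,e_2]=e_4$, $[e_1,e_4]=e_5$, $[e_1,e_5]=e_6$, $[e_2,e_3]=e_6$; $\omega=\lambda(e^{13}+e^{26}-e^{45})$, $\lambda\ne0$. $\mathfrak g_{19}$: $[e_1,e_2]=e_4$, $[e_1,e_4]=e_5$, $[e_1,e_5]=e_6$; $\omega=e^{13}+e^{26}-e^{45}$. $\mathfrak g_{20}$: $[e_1,e_2]=e_3$, $[e_1,e_3]=e_4$, $[e_1,e_4]=e_5$,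 $[e_2,e_3]=e_5$; $\omega=e^{16}+e^{25}-e^{34}$. $\mathfrak g_{22}$: $[e_1,e_2]=e_5$, $[e_1,e_5]=e_6$; $\omega=e^{16}+e^{25}+e^{34}$. *)

(* Defs.v *)
From HB Require Import structures.
From mathcomp Require Import all_boot all_order all_algebra sesquilinear.
From mathcomp Require Import reals.

Set Implicit Arguments.
Unset Strict Implicit.
Unset Printing Implicit Defensive.

Import Order.TTheory GRing.Theory Num.Theory.
Local Open Scope ring_scope.

Section LieAlgebra.
Variables (R : fieldType) (V : vectType R) (br : {bilinear V -> V -> V}).

Definition lie_bracket : Prop :=
  (forall x, br x x = 0) /\
  (forall x y z, br x (br y z) + br y (br z x) + br z (br x y) = 0).

(* By bilinearity it is enough to bracket bases of V and of U. *)
Definition bracket_full (U : {vspace V}) : {vspace V} :=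
  <<[seq br x y | x <- vbasis fullv, y <- vbasis U]>>%VS.

(* lower_central 0 = V, lower_central k.+1 = [V, lower_central k] *)
Definition lower_central (k : nat) : {vspace V} :=
  iter k bracket_full fullv.

Definition nilpotent : Prop := exists k, lower_central k = 0%VS.

Definition lie_ideal (b : {vspace V}) : Prop :=
  forall x y, y \in b -> br x y \in b.

Definition closed_form (w : {skew_symmetric V}) : Prop :=
  forall x y z, w (br x y) z - w (br x z) y + w (br y z) x = 0.

Definition symplectic (w : {skew_symmetric V}) : Prop :=
  nondegenerate w /\ closed_form w.

Definition almost_complex (J : 'End(V)) : Prop :=
  (J \o J = - \1)%VF.

Definition compatible (w : {skew_symmetric V}) (J : 'End(V)) : Prop :=
  forall x y, w (J x) (J y) = w x y.

(* Only the terms b 1, ..., b m of the sequence b are used. *)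
Definition almost_nilpotent (J : 'End(V)) : Prop :=
  exists (m : nat) (b : nat -> {vspace V}),
    [/\ \dim {:V} = m.*2,
        forall i, (0 < i <= m)%N ->
          [/\ lie_ideal (b i), (J @: b i <= b i)%VS & \dim (b i) = i.*2],
        forall i, (0 < i < m)%N -> (b i <= b i.+1)%VS
      & b m = fullv].

Record almost_pseudo_kaehler (g : {symmetric V}) (J : 'End(V))
    (w : {skew_symmetric V}) : Prop := AlmostPseudoKaehler {
  apk_symplectic : symplectic w;
  apk_almost_complex : almost_complex J;
  apk_compatible : compatible w J;
  apk_metric : forall x y, g x y = w x (J y)
}.

End LieAlgebra.

Definition indefinite_pseudo_riemannian (R : realType) (V : vectType R)
    (g : {symmetric V}) : Prop :=
  [/\ nondegenerate g, exists x, 0 < g x x & exists y, g y y < 0].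

Section Coordinates.
Variable R : realType.
Implicit Types x y : 'rV[R]_6.

(* Basis vectors and coordinates are numbered from 1 to 6. *)
Definition idx (i : nat) : 'I_6 := inZp i.-1.

Definition e (i : nat) : 'rV[R]_6 := delta_mx 0 (idx i).

Definition wedge (i j : 'I_6) x y : R := x 0 i * y 0 j - x 0 j * y 0 i.

(* A triple (i, j, v) of the table stands for [e_i, e_j] = v = - [e_j, e_i];
   the brackets of basis vectors that are not in the table are 0. *)
Definition brk (i j : nat) (v : 'rV[R]_6) : nat * nat * 'rV[R]_6 := (i, j, v).

Definition table_bracket (s : seq (nat * nat * 'rV[R]_6)) x y : 'rV[R]_6 :=
  \sum_(q <- s) wedge (idx q.1.1) (idx q.1.2) x y *: q.2.

(* The 2-form whose coefficient on e^{ij} is A i j; thus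
   two_form (E i j) is e^{ij}, and two_form is linear in A. *)
Definition two_form (A : 'M[R]_6) x y : R :=
  \sum_i \sum_j A i j * wedge i j x y.

Definition E (i j : nat) : 'M[R]_6 := delta_mx (idx i) (idx j).

Lemma wedgeC i j x y : wedge i j x y = - wedge i j y x.
Proof. by rewrite /wedge opprB mulrC [x 0 j * _]mulrC. Qed.

Lemma wedgePl i j a x x' y :
  wedge i j (a *: x + x') y = a * wedge i j x y + wedge i j x' y.
Proof.
by rewrite /wedge !mxE !mulrDl mulrBr !mulrA opprD addrACA.
Qed.

Lemma wedgePr i j a x y y' :
  wedge i j x (a *: y + y') = a * wedge i j x y + wedge i j x y'.
Proof. by rewrite wedgeC wedgePl opprD -mulrN -!wedgeC. Qed.

Fact table_bracket_bilinear (s : seq (nat * nat * 'rV[R]_6)) :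
  bilinear_for (GRing.Scale.Law.clone _ _ *:%R _)
    (GRing.Scale.Law.clone _ _ *:%R _) (table_bracket s).
Proof.
split=> [y a x x'|x a y y'] /=; rewrite /table_bracket scaler_sumr -big_split;
  by apply: eq_bigr => q _; rewrite (wedgePl, wedgePr) scalerDl scalerA.
Qed.

HB.instance Definition _ s := bilinear_isBilinear.Build R _ _ _ _ _
  (table_bracket s) (table_bracket_bilinear s).

Fact two_form_bilinear A :
  bilinear_for (GRing.Scale.Law.clone _ _ *%R _)
    (GRing.Scale.Law.clone _ _ (idfun \; *%R) _) (two_form A).
Proof.
split=> [y a x x'|x a y y'] /=; rewrite /two_form mulr_sumr -big_split;
  apply: eq_bigr => i _; rewrite mulr_sumr -big_split;
  by apply: eq_bigr => j _; rewrite (wedgePl, wedgePr) mulrDr mulrCA.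
Qed.

HB.instance Definition _ A := bilinear_isBilinear.Build R _ _ _ _ _
  (two_form A) (two_form_bilinear A).

Fact two_form_skew A x y :
  two_form A x y = (-1) ^+ true * idfun (two_form A y x).
Proof.
rewrite expr1 mulN1r /two_form /= -sumrN; apply: eq_bigr => i _.
by rewrite -sumrN; apply: eq_bigr => j _; rewrite wedgeC mulrN.
Qed.

HB.instance Definition _ A := isHermitianSesquilinear.Build R _ true idfun
  (two_form A) (two_form_skew A).

Definition lie6 (s : seq (nat * nat * 'rV[R]_6)) :
  {bilinear 'rV[R]_6 -> 'rV[R]_6 -> 'rV[R]_6} := table_bracket s.

Definition form6 (A : 'M[R]_6) : {skew_symmetric 'rV[R]_6} := two_form A.

Definition g1 := lie6 [:: brk 1 2 (e 3); brk 1 3 (e 4); brk 1 4 (e 5);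
  brk 1 5 (e 6); brk 2 3 (e 5); brk 2 4 (e 6)].

Definition g2 := lie6 [:: brk 1 2 (e 3); brk 1 3 (e 4); brk 1 4 (e 5);
  brk 1 5 (e 6); brk 2 3 (e 6)].

Definition g3 := lie6 [:: brk 1 2 (e 3); brk 1 3 (e 4); brk 1 4 (e 5);
  brk 1 5 (e 6)].

Definition g4 := lie6 [:: brk 1 2 (e 3); brk 1 3 (e 4); brk 1 4 (e 6);
  brk 2 3 (e 5); brk 2 5 (e 6)].

Definition g5 := lie6 [:: brk 1 2 (e 3); brk 1 3 (e 4); brk 1 4 (- e 6);
  brk 2 3 (e 5); brk 2 5 (e 6)].

Definition g6 := lie6 [:: brk 1 2 (e 3); brk 1 3 (e 4); brk 1 4 (e 5);
  brk 2 3 (e 6)].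

Definition g7 := lie6 [:: brk 1 2 (e 4); brk 1 4 (e 5); brk 1 5 (e 6);
  brk 2 3 (e 6); brk 2 4 (e 6)].

Definition g8 := lie6 [:: brk 1 3 (e 4); brk 1 4 (e 5); brk 1 5 (e 6);
  brk 2 3 (e 5); brk 2 4 (e 6)].

Definition g9 := lie6 [:: brk 1 2 (e 4); brk 1 4 (e 5); brk 1 5 (e 6);
  brk 2 3 (e 6)].

Definition g19 := lie6 [:: brk 1 2 (e 4); brk 1 4 (e 5); brk 1 5 (e 6)].

Definition g20 := lie6 [:: brk 1 2 (e 3); brk 1 3 (e 4); brk 1 4 (e 5);
  brk 2 3 (e 5)].

Definition g22 := lie6 [:: brk 1 2 (e 5); brk 1 5 (e 6)].

Inductive listed : {bilinear 'rV[R]_6 -> 'rV[R]_6 -> 'rV[R]_6} ->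
    {skew_symmetric 'rV[R]_6} -> Prop :=
| Listed1 l of l != 0 & l != 1 :
    listed g1 (form6 (E 1 6 + (1 - l) *: E 2 5 + l *: E 3 4))
| Listed2 l of l != 0 :
    listed g2 (form6 (l *: (E 1 6 + E 2 4 + E 3 4 - E 2 5)))
| Listed3 :
    listed g3 (form6 (E 1 6 - E 2 5 + E 3 4))
| Listed4 l1 l2 of l2 != 0 :
    listed g4 (form6 (l1 *: E 1 4 + l2 *: (E 1 5 + E 1 6 + E 2 4 + E 3 5)))
| Listed5_1 l1 l2 of l2 != 0 :
    listed g5 (form6 (l1 *: E 1 4 + l2 *: (E 1 5 + E 1 6 + E 2 4 + E 3 5)))
| Listed5_2 l of l != 0 :
    listed g5 (form6 (l *: (E 1 6 - 2 *: E 1 5 - 2 *: E 2 4 + E 2 6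
                            + E 3 4 + E 3 5)))
| Listed5_3 l of l != 0 :
    listed g5 (form6 (l *: (E 1 4 - E 1 5 + E 1 6 - E 2 4 + E 2 5 + E 2 6
                            + E 3 4 + E 3 5)))
| Listed5_4 l of l != 0 :
    listed g5 (form6 (l *: (2 *: E 1 4 + E 1 6 + 2 *: E 2 5 + E 2 6
                            + E 3 4 + E 3 5)))
| Listed6_1 :
    listed g6 (form6 (E 1 6 + E 2 4 + E 2 5 - E 3 4))
| Listed6_2 :
    listed g6 (form6 (- (E 1 6 + E 2 4 + E 2 5 - E 3 4)))
| Listed7_1 l of l != 0 :
    listed g7 (form6 (l *: (E 1 3 + E 2 6 - E 4 5)))
| Listed7_2 l of l != 0 :
    listed g7 (form6 (l *: (E 1 6 + E 2 5 - E 3 4)))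
| Listed8 :
    listed g8 (form6 (E 1 6 + E 2 5 - E 3 4))
| Listed9 l of l != 0 :
    listed g9 (form6 (l *: (E 1 3 + E 2 6 - E 4 5)))
| Listed19 :
    listed g19 (form6 (E 1 3 + E 2 6 - E 4 5))
| Listed20 :
    listed g20 (form6 (E 1 6 + E 2 5 - E 3 4))
| Listed22 :
    listed g22 (form6 (E 1 6 + E 2 5 + E 3 4)).

End Coordinates.

(* Main.v *)
(** In each of the listed algebras there are ideals [b1 < b2] of dimensions 2
and 4 such that [b2] is the [w]-orthogonal of [b1]. Since [b1] is isotropic, a
rational Gram-Schmidt process gives a Darboux basis [p1, p2, p3, q1, q2, q3]
with [b1 = <q1, q2>] and [b2 = <p3, q3, q1, q2>]. The endomorphism
[J p1 = p2, J q1 = q2, J p3 = q3] with [J^2 = - 1] is then compatible with [w]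
and preserves [b1] and [b2]. As [b1] is isotropic for [w] and stable by [J], it
is totally isotropic for [g x y = w x (J y)], so [g] is indefinite:
[g (p1 - q2) (p1 - q2) = 2] and [g (p1 + q2) (p1 + q2) = - 2]. *)

From HB Require Import structures.
Require Import Defs.
From mathcomp Require Import all_boot all_order all_algebra sesquilinear.
From mathcomp Require Import reals ring lra.

Set Implicit Arguments.
Unset Strict Implicit.
Unset Printing Implicit Defensive.

Import Order.TTheory GRing.Theory Num.Theory.
Local Open Scope ring_scope.

(** * Nondegenerate forms, skew forms and the metric of a compatible structure *)

Lemma nondegenerateP (R : fieldType) (V : vectType R) (eps : bool)
    (theta : {rmorphism R -> R}) (f : {hermitian V for eps & theta}) :
  reflect (forall x, (forall y, f x y = 0) -> x = 0) (nondegenerate f).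
Proof.
(* The radical is the orthogonal of [fullv], a subspace, so its vanishing is tested on elements. *)
apply: (iffP eqP) => [radf0 x fx0|f_inj].
  by apply/eqP; rewrite -memv0 -radf0; apply/mem_orthovP => y _; exact: fx0.
apply/vspaceP => x; rewrite memv0; apply/idP/eqP => [/mem_orthovP x_rad|->].
  by apply: f_inj => y; rewrite x_rad ?memvf.
exact: mem0v.
Qed.

Section SkewForm.
Variables (R : realType) (V : vectType R) (w : {skew_symmetric V}).

Lemma skewC x y : w x y = - w y x.
Proof. by rewrite hermC expr1 mulN1r. Qed.

Lemma skew_self x : w x x = 0.
Proof. by have := skewC x x; lra. Qed.

Lemma skewDl x y t : w (x + y) t = w x t + w y t.
Proof. exact: linearDl. Qed.

Lemma skewNl x t : w (- x) t = - w x t.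
Proof. exact: linearNl. Qed.

Lemma skewZl a x t : w (a *: x) t = a * w x t.
Proof. exact: linearZl_LR. Qed.

Lemma skewDr x y t : w t (x + y) = w t x + w t y.
Proof. exact: linearDr. Qed.

Lemma skewNr x t : w t (- x) = - w t x.
Proof. exact: linearNr. Qed.

Lemma skewZr a x t : w t (a *: x) = a * w t x.
Proof. exact: linearZr_LR. Qed.

Definition skew_linE := (skewDl, skewNl, skewZl, skewDr, skewNr, skewZr).

End SkewForm.

Section MetricOf.
Variables (R : realType) (V : vectType R).
Variables (w : {skew_symmetric V}) (J : 'End(V)).

Definition metric_of x y : R := w x (J y).

Fact metric_of_bilinear :
  bilinear_for (GRing.Scale.Law.clone _ _ *%R _)
    (GRing.Scale.Law.clone _ _ (idfun \; *%R) _) metric_of.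
Proof.
split=> [y a x x'|x a y y'] /=; first by rewrite /metric_of linearPl.
by rewrite /metric_of linearP /= linearPr.
Qed.

HB.instance Definition _ := bilinear_isBilinear.Build R _ _ _ _ _
  metric_of metric_of_bilinear.

Hypotheses (J2 : almost_complex J) (wJ : compatible w J).

Lemma almost_complexE x : J (J x) = - x.
Proof.
by have /lfunP/(_ x) := J2; rewrite comp_lfunE opp_lfunE id_lfunE.
Qed.

(** Compatibility and [J^2 = - 1] give [w x (J y) = w (J x) (J (J y)) = - w (J x) y], which is
    [w y (J x)] by skew-symmetry. *)
Fact metric_of_sym x y :
  metric_of x y = (-1) ^+ false * idfun (metric_of y x).
Proof.
by rewrite expr0 mul1r /= /metric_of -wJ almost_complexE linearNr /= [RHS]skewC.
Qed.

(** Symmetry depends on the hypotheses [J2] and [wJ], so the structure is packed by hand from their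
    proofs. *)
Definition sym_metric_of : {symmetric V} :=
  HB.pack_for {symmetric V} metric_of
    (isHermitianSesquilinear.Build R V false idfun metric_of metric_of_sym).

End MetricOf.

(** * Darboux bases *)

Record darboux (R : realType) (V : vectType R) (w : {skew_symmetric V})
    (p1 p2 p3 q1 q2 q3 : V) : Prop := Darboux {
  darboux_pp12 : w p1 p2 = 0;
  darboux_pp13 : w p1 p3 = 0;
  darboux_pp23 : w p2 p3 = 0;
  darboux_qq12 : w q1 q2 = 0;
  darboux_qq13 : w q1 q3 = 0;
  darboux_qq23 : w q2 q3 = 0;
  darboux_pq11 : w p1 q1 = 1;
  darboux_pq12 : w p1 q2 = 0;
  darboux_pq13 : w p1 q3 = 0;
  darboux_pq21 : w p2 q1 = 0;
  darboux_pq22 : w p2 q2 = 1;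
  darboux_pq23 : w p2 q3 = 0;
  darboux_pq31 : w p3 q1 = 0;
  darboux_pq32 : w p3 q2 = 0;
  darboux_pq33 : w p3 q3 = 1
}.

Section GramSchmidt.
Variables (R : realType) (V : vectType R) (w : {skew_symmetric V}).
Variables x1 x2 v v' u z : V.
Hypotheses (w2z : w x2 z = 0) (wvz : w v z = 0) (wv'z : w v' z = 0)
  (wuz : w u z = 0) (wvu : w v u = 0) (wv'u : w v' u = 0)
  (w1z : w x1 z != 0) (w2u : w x2 u != 0) (wvv' : w v v' != 0).

(** Every correction term lies in [<u, z>], which is orthogonal to [<v, v', u, z>]; hence the
    corrections leave the pairings inside that space unchanged. Only the three nonzero pairings are
    divided by, so no square root occurs. *)
Lemma darboux_exists : exists p1 p2 p3 q1 q2 q3,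
  [/\ darboux w p1 p2 p3 q1 q2 q3,
      q1 \in <<[:: u; z]>>%VS, q2 \in <<[:: u; z]>>%VS,
      p3 \in <<[:: v; v'; u; z]>>%VS & q3 \in <<[:: v; v'; u; z]>>%VS].
Proof.
pose q1 := (w x1 z)^-1 *: z.
(* The multiple of [z] cancels the pairing with [x1]; the one with [x2] is unaffected since
   [w x2 z = 0]. *)
pose q2 := (w x2 u)^-1 *: (u - (w x1 u / w x1 z) *: z).
(* As [w q2 x2 = -1], this makes [p1] orthogonal to [x2], which itself serves as [p2]. *)
pose p1 := x1 + w x1 x2 *: q2.
pose p3 := v - w x1 v *: q1 - w x2 v *: q2.
pose q3 := (w v v')^-1 *: (v' - w x1 v' *: q1 - w x2 v' *: q2).
have subS : (<<[:: u; z]>> <= <<[:: v; v'; u; z]>>)%VS.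
  by apply: sub_span => y; rewrite !inE => /orP[] ->; rewrite !orbT.
have q1_in : q1 \in <<[:: u; z]>>%VS.
  by rewrite rpredZ // memv_span // !inE eqxx orbT.
have q2_in : q2 \in <<[:: u; z]>>%VS.
  by rewrite rpredZ // rpredB ?rpredZ // memv_span // !inE eqxx ?orbT.
have q1_in2 := subvP subS _ q1_in; have q2_in2 := subvP subS _ q2_in.
exists p1, x2, p3, q1, q2, q3; split=> //.
- rewrite /q3 /p3 /p1 /q2 /q1.
  have C := skewC w.
  by split; rewrite !skew_linE ?skew_self ?(C u z) ?(C z u)
      ?(C z v) ?(C z v') ?(C u v) ?(C u v') ?(C z x2) ?(C u x2) ?(C x2 x1)
      ?(C z x1) ?(C u x1) ?w2z ?wvz ?wv'z ?wuz ?wvu ?wv'u;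
    field; rewrite ?w1z ?w2u ?wvv'.
- by rewrite /p3 !rpredB 1?rpredZ // memv_span ?mem_head.
- by rewrite /q3 rpredZ // !rpredB 1?rpredZ // memv_span // !inE eqxx orbT.
Qed.

End GramSchmidt.

(** * The complex structure and the metric attached to a Darboux basis *)

Section DarbouxStructure.
Variables (R : realType) (V : vectType R) (w : {skew_symmetric V}).
Variables p1 p2 p3 q1 q2 q3 : V.
Hypothesis D : darboux w p1 p2 p3 q1 q2 q3.

Let C := skewC w.

Let wE : (((w p1 p2 = 0) * (w p1 p3 = 0) * (w p2 p3 = 0)
  * (w q1 q2 = 0) * (w q1 q3 = 0) * (w q2 q3 = 0)
  * (w p1 q1 = 1) * (w p1 q2 = 0) * (w p1 q3 = 0)
  * (w p2 q1 = 0) * (w p2 q2 = 1) * (w p2 q3 = 0)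
  * (w p3 q1 = 0) * (w p3 q2 = 0) * (w p3 q3 = 1))
  * ((w p2 p1 = 0) * (w p3 p1 = 0) * (w p3 p2 = 0)
  * (w q2 q1 = 0) * (w q3 q1 = 0) * (w q3 q2 = 0)
  * (w q1 p1 = -1) * (w q2 p1 = 0) * (w q3 p1 = 0)
  * (w q1 p2 = 0) * (w q2 p2 = -1) * (w q3 p2 = 0)
  * (w q1 p3 = 0) * (w q2 p3 = 0) * (w q3 p3 = -1)))%type.
Proof.
case: D => h1 h2 h3 h4 h5 h6 h7 h8 h9 h10 h11 h12 h13 h14 h15.
rewrite (C p2 p1) (C p3 p1) (C p3 p2) (C q2 q1) (C q3 q1)
  (C q3 q2) (C q1 p1) (C q2 p1) (C q3 p1) (C q1 p2) (C q2 p2) (C q3 p2)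
  (C q1 p3) (C q2 p3) (C q3 p3).
by rewrite !(h1, h2, h3, h4, h5, h6, h7, h8, h9, h10, h11, h12, h13, h14, h15)
  oppr0.
Qed.

Let basisD := [tuple p1; p2; p3; q1; q2; q3].

(** Pairing with [q_i] extracts the coefficient of [p_i], and pairing with [p_i] extracts minus that
    of [q_i]. *)
Lemma darboux_independent (k : 'I_6 -> R) (x := \sum_i k i *: basisD`_i) :
  [/\ w x p1 = 0, w x p2 = 0 & w x p3 = 0] ->
  [/\ w x q1 = 0, w x q2 = 0 & w x q3 = 0] -> forall i, k i = 0.
Proof.
rewrite /x !big_ord_recl big_ord0 /= addr0.
rewrite !skew_linE !skew_self !wE !(mulr0, mulr1, mulrN1, addr0, add0r).
case=> /eqP + /eqP + /eqP; rewrite !oppr_eq0 => /eqP k3 /eqP k4 /eqP k5.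
case=> k0 k1 k2 [[|[|[|[|[|[|]]]]]] // i_lt6];
  [rewrite -[RHS]k0 | rewrite -[RHS]k1 | rewrite -[RHS]k2 | rewrite -[RHS]k3
  | rewrite -[RHS]k4 | rewrite -[RHS]k5]; congr (k _); exact: val_inj.
Qed.

Lemma darboux_free : free [:: p1; p2; p3; q1; q2; q3].
Proof.
apply/(@freeP _ _ 6 basisD) => k k0.
apply: darboux_independent; rewrite k0; split; exact: linear0l.
Qed.

Hypothesis dimV : \dim {:V} = 6.

(** Six independent vectors span a space of dimension 6, so the pairings with them separate points.
    Vector identities about [J] are reduced by this to scalar ones. *)
Lemma darboux_ext x y :
  [/\ w x p1 = w y p1, w x p2 = w y p2 & w x p3 = w y p3] ->
  [/\ w x q1 = w y q1, w x q2 = w y q2 & w x q3 = w y q3] -> x = y.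
Proof.
move=> [xp1 xp2 xp3] [xq1 xq2 xq3]; apply/eqP; rewrite -subr_eq0.
have : x - y \in <<basisD>>%VS.
  suff -> : <<basisD>>%VS = fullv by exact: memvf.
  apply/eqP; rewrite eqEdim subvf dimV.
  by have := darboux_free; rewrite /free => /eqP ->.
move=> /coord_span xy; rewrite xy big1 // => i _.
rewrite (darboux_independent (k := coord basisD ^~ (x - y))) ?scale0r // -xy
  !skew_linE.
- by rewrite xp1 xp2 xp3 !subrr.
- by rewrite xq1 xq2 xq3 !subrr.
Qed.

Lemma darboux_nondegenerate : nondegenerate w.
Proof.
apply/nondegenerateP => x wx0.
by apply: darboux_ext; split; rewrite wx0 linear0l.
Qed.

(** Since [x] has coefficient [w x q_i] on [p_i] and [- w x p_i] on [q_i], this is the map with [p1]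
    sent to [p2], [q1] to [q2], [p3] to [q3] and square [- 1]. The metric is neutral on
    [<p1, p2, q1, q2>] and positive on [<p3, q3>]. *)
Definition darboux_J_fun x : V :=
  w x q1 *: p2 - w x q2 *: p1 + w x q3 *: q3
  + w x p3 *: p3 + w x p2 *: q1 - w x p1 *: q2.

Let JE x : ((w (darboux_J_fun x) p1 = - w x p2)
  * (w (darboux_J_fun x) p2 = w x p1)
  * (w (darboux_J_fun x) p3 = - w x q3)
  * (w (darboux_J_fun x) q1 = - w x q2)
  * (w (darboux_J_fun x) q2 = w x q1)
  * (w (darboux_J_fun x) q3 = w x p3))%type.
Proof. by do !split; rewrite !skew_linE !skew_self !wE; ring. Qed.

Fact darboux_J_linear : linear darboux_J_fun.
Proof.
by move=> a x y; apply: darboux_ext; split; rewrite !(JE, skew_linE); ring.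
Qed.

HB.instance Definition _ :=
  GRing.isLinear.Build R V V *:%R darboux_J_fun darboux_J_linear.

Definition darboux_J : 'End(V) := linfun darboux_J_fun.

Lemma darboux_J_almost_complex : almost_complex darboux_J.
Proof.
apply/lfunP => x; rewrite comp_lfunE opp_lfunE id_lfunE !lfunE /=.
by apply: darboux_ext; split; rewrite !(JE, skew_linE).
Qed.

Lemma darboux_J_compatible : compatible w darboux_J.
Proof.
(* [J x] is abstracted, keeping only its pairings, so that linearity expands [J y] alone. *)
move=> x y; rewrite !lfunE /=; move: (darboux_J_fun x) (JE x) => Jx JxE.
rewrite !skew_linE !JxE.
have -> : y = w y q1 *: p1 + w y q2 *: p2 + w y q3 *: p3
    - w y p1 *: q1 - w y p2 *: q2 - w y p3 *: q3.
  by apply: darboux_ext; split; rewrite !skew_linE !skew_self !wE; ring.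
by rewrite !skew_linE !skew_self !wE; ring.
Qed.

Let J_values : ((darboux_J p1 = p2)
  * (darboux_J q1 = q2) * (darboux_J q2 = - q1)
  * (darboux_J p3 = q3) * (darboux_J q3 = - p3))%type.
Proof.
by do !split; rewrite lfunE /=; apply: darboux_ext; split;
  rewrite !(JE, skew_linE) ?skew_self ?wE ?oppr0 ?opprK.
Qed.

Lemma darboux_J_stable2 : (darboux_J @: <<[:: q1; q2]>> <= <<[:: q1; q2]>>)%VS.
Proof.
rewrite limg_span; apply/span_subvP => y; rewrite /= !J_values !inE.
by case/pred2P=> ->; rewrite ?memvN memv_span ?inE ?eqxx ?orbT.
Qed.

Lemma darboux_J_stable4 :
  (darboux_J @: <<[:: p3; q1; q2; q3]>> <= <<[:: p3; q1; q2; q3]>>)%VS.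
Proof.
rewrite limg_span; apply/span_subvP => y; rewrite /= !J_values !inE.
by case/or4P=> /eqP->; rewrite ?memvN memv_span ?inE ?eqxx ?orbT.
Qed.

Definition darboux_metric : {symmetric V} :=
  sym_metric_of darboux_J_almost_complex darboux_J_compatible.

Lemma darboux_metricE x y : darboux_metric x y = w x (darboux_J y).
Proof. by []. Qed.

Lemma darboux_metric_indefinite : indefinite_pseudo_riemannian darboux_metric.
Proof.
have J2 := almost_complexE darboux_J_almost_complex.
split.
(* [J] is invertible: testing [g x] on [J y] gives [- w x y], so nondegeneracy of [w] applies. *)
- apply/nondegenerateP => x gx0.
  move/nondegenerateP: darboux_nondegenerate; apply=> y; have := gx0 (darboux_J y).
  by rewrite darboux_metricE J2 skewNr => /eqP; rewrite oppr_eq0 => /eqP.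
- exists (p1 - q2); rewrite darboux_metricE linearB /= !J_values.
  by rewrite !skew_linE ?skew_self !wE; lra.
- exists (p1 + q2); rewrite darboux_metricE linearD /= !J_values.
  by rewrite !skew_linE ?skew_self !wE; lra.
Qed.

End DarbouxStructure.

(** * Flags of ideals *)

Section FlagStructure.
Variables (R : realType) (V : vectType R) (br : {bilinear V -> V -> V}).
Variables (w : {skew_symmetric V}) (x1 x2 v v' u z : V).

(* The ideals are [<u, z>] and its [w]-orthogonal [<v, v', u, z>]; the vectors
   [x1], [x2] pair with [z], [u], and [v] with [v']. *)
Lemma almost_pseudo_kaehler_of_flag (a b c : R) :
  \dim {:V} = 6 -> lie_bracket br -> nilpotent br -> closed_form br w ->
  (forall x y, br x y \in <<[:: v; v'; u; z]>>%VS) ->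
  (forall x, br x u \in <[z]>%VS) -> (forall x, br x z = 0) ->
  [/\ w x2 z = 0, w v z = 0 & w v' z = 0] ->
  [/\ w u z = 0, w v u = 0 & w v' u = 0] ->
  [/\ w x1 z = a, w x2 u = b & w v v' = c] ->
  [/\ a != 0, b != 0 & c != 0] ->
  [/\ lie_bracket br, nilpotent br, symplectic br w
    & exists (J : 'End(V)) (g : {symmetric V}),
        [/\ almost_pseudo_kaehler br g J w, almost_nilpotent br J
          & indefinite_pseudo_riemannian g]].
Proof.
move=> dimV br_lie br_nil w_closed br_b2 br_u br_z.
(* The scalars [a], [b], [c] give way to the pairings they name; they let each application state
   explicit values whose nonvanishing is easy to check. *)
move=> [w2z wvz wv'z] [wuz wvu wv'u] [<- <- <-] [w1z w2u wvv'].
have [p1 [p2 [p3 [q1 [q2 [q3 [D q1b q2b p3b q3b]]]]]]] :=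
  darboux_exists w2z wvz wv'z wuz wvu wv'u w1z w2u wvv'.
have w_symp : symplectic br w.
  by split=> //; exact: darboux_nondegenerate D dimV.
split=> //; exists (darboux_J w p1 p2 p3 q1 q2 q3), (darboux_metric D dimV).
split; last exact: darboux_metric_indefinite.
  split=> //; [exact: darboux_J_almost_complex | exact: darboux_J_compatible].
have freeD := darboux_free D.
(* Both lists are consecutive segments of the Darboux basis, so freeness follows by cutting off the
   ends. *)
have free4 : free [:: p3; q1; q2; q3] by apply: (@catr_free _ _ [:: p1; p2]).
have free2 : free [:: q1; q2]
  by apply: (@catl_free _ _ [:: q3]); apply: (@catr_free _ _ [:: p3]).
(* The free family lies in a span of as many generators, so the dimensions force equality; likewise
   for [b2E]. *)
have b1E : <<[:: u; z]>>%VS = <<[:: q1; q2]>>%VS.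
  apply/esym/eqP; rewrite eqEdim (eqP free2) dim_span andbT.
  by apply/span_subvP => y; rewrite !inE => /pred2P[] ->.
have sub12 : (<<[:: u; z]>> <= <<[:: v; v'; u; z]>>)%VS.
  by apply: sub_span => y; rewrite !inE => /orP[] ->; rewrite !orbT.
have b2E : <<[:: v; v'; u; z]>>%VS = <<[:: p3; q1; q2; q3]>>%VS.
  apply/esym/eqP; rewrite eqEdim (eqP free4) dim_span andbT.
  apply/span_subvP => y; rewrite !inE.
  by case/or4P=> /eqP-> //; apply: subvP sub12 _ _.
(* The entry of index 0 is a placeholder, and index 3 runs past the list, so the default [fullv] is
   the last ideal. *)
exists 3%N, (nth fullv [:: fullv; <<[:: u; z]>>; <<[:: v; v'; u; z]>>]%VS).
split=> //; first (case=> [|[|[|[|]]]] //= _; split).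
(* Bracketing [s u + t z] leaves only [s [x, u]], a multiple of [z]. The second space is an ideal
   because it contains all brackets. *)
- move=> x y; rewrite span_cons => /memv_addP[_ /vlineP[s ->] [y']].
  rewrite span_seq1 => /vlineP[t -> ->].
  rewrite linearDr linearZr_LR linearZr_LR /= br_z scaler0 addr0.
  have /vlineP[d ->] := br_u x.
  by rewrite !memvZ // (subvP (addvSr _ _)) ?memv_line.
- by rewrite b1E; exact: darboux_J_stable2.
- by rewrite b1E (eqP free2).
- by move=> x y _; exact: br_b2.
- by rewrite b2E; exact: darboux_J_stable4.
- by rewrite b2E (eqP free4).
- by move=> x y _; rewrite memvf.
- exact: subvf.
- by rewrite dimV.
- by case=> [|[|[|]]] //= _; exact: subvf.
Qed.

End FlagStructure.

(** * Brackets and forms in coordinates *)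

Section Tables.
Variable R : realType.
Implicit Types (s : seq (nat * nat * 'rV[R]_6)) (x y : 'rV[R]_6).

Lemma rV6P x y :
  [/\ x 0 (idx 1) = y 0 (idx 1), x 0 (idx 2) = y 0 (idx 2)
    & x 0 (idx 3) = y 0 (idx 3)] ->
  [/\ x 0 (idx 4) = y 0 (idx 4), x 0 (idx 5) = y 0 (idx 5)
    & x 0 (idx 6) = y 0 (idx 6)] -> x = y.
Proof.
move=> [h1 h2 h3] [h4 h5 h6]; apply/rowP.
case=> [[|[|[|[|[|[|]]]]]] // i_lt6];
  [move: h1 | move: h2 | move: h3 | move: h4 | move: h5 | move: h6];
  by congr (_ = _); congr (_ _ _); apply: val_inj.
Qed.

Lemma table_coordE s x y k : table_bracket s x y 0 k =
  \sum_(q <- s) wedge (idx q.1.1) (idx q.1.2) x y * q.2 0 k.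
Proof.
by rewrite /table_bracket summxE; apply: eq_bigr => q _; rewrite mxE.
Qed.

Lemma rVN_coordE x k : (- x) 0 k = - x 0 k.
Proof. exact: mxE. Qed.

Lemma rVD_coordE x y k : (x + y) 0 k = x 0 k + y 0 k.
Proof. exact: mxE. Qed.

Lemma e_coordE i j : e R i 0 (idx j) = ((i.-1 %% 6)%N == (j.-1 %% 6)%N)%:R.
Proof. by rewrite mxE eqxx eq_sym. Qed.

Lemma memv_line_e6 x :
  [/\ x 0 (idx 1) = 0, x 0 (idx 2) = 0 & x 0 (idx 3) = 0] ->
  x 0 (idx 4) = 0 /\ x 0 (idx 5) = 0 -> x \in <[e R 6]>%VS.
Proof.
move=> [x1 x2 x3] [x4 x5]; apply/vlineP; exists (x 0 (idx 6)).
by apply: rV6P; split;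
  rewrite [RHS]mxE !e_coordE ?(x1, x2, x3, x4, x5) ?mulr0 ?mulr1.
Qed.

Lemma table_bracket_alternate s x : table_bracket s x x = 0.
Proof.
rewrite /table_bracket big1 // => q _.
by rewrite /wedge mulrC subrr scale0r.
Qed.

Definition triangular (q : nat * nat * 'rV[R]_6) : bool :=
  [forall k : 'I_6, (k <= maxn (idx q.1.1) (idx q.1.2))%N ==> (q.2 0 k == 0)].

Lemma triangular_brk i j l :
  (maxn (idx i) (idx j) < idx l)%N -> triangular (brk i j (e R l)).
Proof.
move=> ij_lt; apply/forallP => k; apply/implyP => k_le.
have /negPf k_neq : k != idx l.
  by rewrite -val_eqE; apply/negbT/ltn_eqF; exact: leq_ltn_trans ij_lt.
by rewrite mxE eqxx k_neq.
Qed.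

Lemma triangular_brkN i j v :
  triangular (brk i j v) -> triangular (brk i j (- v)).
Proof.
move=> /forallP v0; apply/forallP => k; apply/implyP => /(implyP (v0 k)) /=.
by rewrite mxE oppr_eq0.
Qed.

(** A triangular bracket of basis vectors involves only later basis vectors, so each step of the
    lower central series kills one more leading coordinate, and six steps kill all. *)
Lemma table_bracket_nilpotent s : all triangular s -> nilpotent (lie6 s).
Proof.
move=> /allP s_tri; exists 6%N.
suff lcs k x : x \in lower_central (lie6 s) k ->
    forall i : 'I_6, (i < k)%N -> x 0 i = 0.
  apply/eqP; rewrite -subv0; apply/subvP => x /lcs x0.
  by rewrite memv0; apply/eqP/rowP => i; rewrite mxE x0.
elim: k x => [//|k IHk] x x_in i i_le.
have br0 a b : b \in lower_central (lie6 s) k -> table_bracket s a b 0 i = 0.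
  move=> /IHk b0; rewrite table_coordE big_seq big1 // => q q_in.
  (* Either [i] does not exceed the larger index and the table vector vanishes there, or both
     indices are below [i <= k] and [b] vanishes at them. *)
  have [i_le_max|] := leqP i (maxn (idx q.1.1) (idx q.1.2)).
    by rewrite (eqP (implyP (forallP (s_tri q q_in) i) i_le_max)) mulr0.
  rewrite gtn_max => /andP[i1 i2].
  by rewrite /wedge !b0 ?mulr0 ?subrr ?mul0r // (leq_trans _ (i_le : i <= k)%N).
move: x_in; rewrite /= /bracket_full => /(@coord_span _ _ _ (in_tuple _)) ->.
rewrite summxE big1 // => j _; rewrite mxE.
have /allpairsP[[a b] /= [_ b_in ->]] := mem_nth 0 (ltn_ord j).
by rewrite br0 ?mulr0 // vbasis_mem.
Qed.

(** Needed for the flags with [u = e 4 - e 5], where [e 5] is not itself a generator. *)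
Lemma memv_of_sub (U : {vspace 'rV[R]_6}) x y :
  x \in U -> x - y \in U -> y \in U.
Proof. by move=> xU xyU; rewrite -[y](subKr x) memvB. Qed.

Lemma table_bracket_in s (U : {vspace 'rV[R]_6}) x y :
  all (fun q => q.2 \in U) s -> table_bracket s x y \in U.
Proof.
move=> /allP s_in; rewrite /table_bracket big_seq.
by apply: memv_suml => q /s_in q_in; exact: memvZ.
Qed.

Lemma two_formD (A B : 'M[R]_6) x y :
  two_form (A + B) x y = two_form A x y + two_form B x y.
Proof.
rewrite /two_form -big_split; apply: eq_bigr => i _.
by rewrite -big_split; apply: eq_bigr => j _; rewrite mxE mulrDl.
Qed.

Lemma two_formZ a (A : 'M[R]_6) x y :
  two_form (a *: A) x y = a * two_form A x y.
Proof.
rewrite /two_form mulr_sumr; apply: eq_bigr => i _.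
by rewrite mulr_sumr; apply: eq_bigr => j _; rewrite mxE mulrA.
Qed.

Lemma two_formN (A : 'M[R]_6) x y : two_form (- A) x y = - two_form A x y.
Proof. by rewrite -scaleN1r two_formZ mulN1r. Qed.

Lemma two_form_E i j x y : two_form (E R i j) x y = wedge (idx i) (idx j) x y.
Proof.
rewrite /two_form (bigD1 (idx i)) //= (bigD1 (idx j)) //= !mxE !eqxx mul1r.
rewrite big1 ?addr0 => [|k /negPf k_neq]; last by rewrite mxE k_neq andbF mul0r.
rewrite big1 ?addr0 // => k /negPf k_neq; rewrite big1 // => l _.
by rewrite mxE k_neq mul0r.
Qed.

Lemma form6E A x y : form6 A x y = two_form A x y.
Proof. by []. Qed.

Definition form_coordE := (form6E, two_formD, two_formZ, two_formN, two_form_E).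

End Tables.

(** * The twelve algebras *)

Local Notation W i j := (wedge (idx i) (idx j)).

Ltac bracket_coords :=
  by do !split; rewrite [LHS]table_coordE !big_cons big_nil
    ?rVN_coordE !e_coordE /= ?(mulr0, mulr1, mulrN, oppr0, addr0, add0r) ?addrA.

(** The coordinate rules are used twice, on the outer bracket and, once [wedge] is unfolded, on the
    inner one; the Jacobi identity becomes polynomial. *)
Ltac lie_bracket_by coordE :=
  split=> [x|x y z]; [exact: table_bracket_alternate|];
  by apply: rV6P; split;
    rewrite !rVD_coordE [RHS]mxE !coordE /wedge ?coordE /wedge; ring.

Ltac nilpotent_by_table :=
  by apply: table_bracket_nilpotent;
    rewrite /= ?triangular_brkN ?triangular_brk.

Section Algebras.
Variable R : realType.
Implicit Types x y z : 'rV[R]_6.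

Lemma g1_coordE x y :
  ((g1 R x y 0 (idx 1) = 0) * (g1 R x y 0 (idx 2) = 0)
  * (g1 R x y 0 (idx 3) = W 1 2 x y)
  * (g1 R x y 0 (idx 4) = W 1 3 x y)
  * (g1 R x y 0 (idx 5) = (W 1 4 x y + W 2 3 x y)%R)
  * (g1 R x y 0 (idx 6) = (W 1 5 x y + W 2 4 x y)%R))%type.
Proof. bracket_coords. Qed.

Lemma g1_lie : lie_bracket (g1 R).
Proof. lie_bracket_by g1_coordE. Qed.

Lemma g1_nilpotent : nilpotent (g1 R).
Proof. nilpotent_by_table. Qed.

Lemma g2_coordE x y :
  ((g2 R x y 0 (idx 1) = 0) * (g2 R x y 0 (idx 2) = 0)
  * (g2 R x y 0 (idx 3) = W 1 2 x y)
  * (g2 R x y 0 (idx 4) = W 1 3 x y)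
  * (g2 R x y 0 (idx 5) = W 1 4 x y)
  * (g2 R x y 0 (idx 6) = (W 1 5 x y + W 2 3 x y)%R))%type.
Proof. bracket_coords. Qed.

Lemma g2_lie : lie_bracket (g2 R).
Proof. lie_bracket_by g2_coordE. Qed.

Lemma g2_nilpotent : nilpotent (g2 R).
Proof. nilpotent_by_table. Qed.

Lemma g3_coordE x y :
  ((g3 R x y 0 (idx 1) = 0) * (g3 R x y 0 (idx 2) = 0)
  * (g3 R x y 0 (idx 3) = W 1 2 x y)
  * (g3 R x y 0 (idx 4) = W 1 3 x y)
  * (g3 R x y 0 (idx 5) = W 1 4 x y)
  * (g3 R x y 0 (idx 6) = W 1 5 x y))%type.
Proof. bracket_coords. Qed.

Lemma g3_lie : lie_bracket (g3 R).
Proof. lie_bracket_by g3_coordE. Qed.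

Lemma g3_nilpotent : nilpotent (g3 R).
Proof. nilpotent_by_table. Qed.

Lemma g4_coordE x y :
  ((g4 R x y 0 (idx 1) = 0) * (g4 R x y 0 (idx 2) = 0)
  * (g4 R x y 0 (idx 3) = W 1 2 x y)
  * (g4 R x y 0 (idx 4) = W 1 3 x y)
  * (g4 R x y 0 (idx 5) = W 2 3 x y)
  * (g4 R x y 0 (idx 6) = (W 1 4 x y + W 2 5 x y)%R))%type.
Proof. bracket_coords. Qed.

Lemma g4_lie : lie_bracket (g4 R).
Proof. lie_bracket_by g4_coordE. Qed.

Lemma g4_nilpotent : nilpotent (g4 R).
Proof. nilpotent_by_table. Qed.

Lemma g5_coordE x y :
  ((g5 R x y 0 (idx 1) = 0) * (g5 R x y 0 (idx 2) = 0)
  * (g5 R x y 0 (idx 3) = W 1 2 x y)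
  * (g5 R x y 0 (idx 4) = W 1 3 x y)
  * (g5 R x y 0 (idx 5) = W 2 3 x y)
  * (g5 R x y 0 (idx 6) = (- W 1 4 x y + W 2 5 x y)%R))%type.
Proof. bracket_coords. Qed.

Lemma g5_lie : lie_bracket (g5 R).
Proof. lie_bracket_by g5_coordE. Qed.

Lemma g5_nilpotent : nilpotent (g5 R).
Proof. nilpotent_by_table. Qed.

Lemma g6_coordE x y :
  ((g6 R x y 0 (idx 1) = 0) * (g6 R x y 0 (idx 2) = 0)
  * (g6 R x y 0 (idx 3) = W 1 2 x y)
  * (g6 R x y 0 (idx 4) = W 1 3 x y)
  * (g6 R x y 0 (idx 5) = W 1 4 x y)
  * (g6 R x y 0 (idx 6) = W 2 3 x y))%type.
Proof. bracket_coords. Qed.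

Lemma g6_lie : lie_bracket (g6 R).
Proof. lie_bracket_by g6_coordE. Qed.

Lemma g6_nilpotent : nilpotent (g6 R).
Proof. nilpotent_by_table. Qed.

Lemma g7_coordE x y :
  ((g7 R x y 0 (idx 1) = 0) * (g7 R x y 0 (idx 2) = 0)
  * (g7 R x y 0 (idx 3) = 0)
  * (g7 R x y 0 (idx 4) = W 1 2 x y)
  * (g7 R x y 0 (idx 5) = W 1 4 x y)
  * (g7 R x y 0 (idx 6) = (W 1 5 x y + W 2 3 x y + W 2 4 x y)%R))%type.
Proof. bracket_coords. Qed.

Lemma g7_lie : lie_bracket (g7 R).
Proof. lie_bracket_by g7_coordE. Qed.

Lemma g7_nilpotent : nilpotent (g7 R).
Proof. nilpotent_by_table. Qed.

Lemma g8_coordE x y :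
  ((g8 R x y 0 (idx 1) = 0) * (g8 R x y 0 (idx 2) = 0)
  * (g8 R x y 0 (idx 3) = 0)
  * (g8 R x y 0 (idx 4) = W 1 3 x y)
  * (g8 R x y 0 (idx 5) = (W 1 4 x y + W 2 3 x y)%R)
  * (g8 R x y 0 (idx 6) = (W 1 5 x y + W 2 4 x y)%R))%type.
Proof. bracket_coords. Qed.

Lemma g8_lie : lie_bracket (g8 R).
Proof. lie_bracket_by g8_coordE. Qed.

Lemma g8_nilpotent : nilpotent (g8 R).
Proof. nilpotent_by_table. Qed.

Lemma g9_coordE x y :
  ((g9 R x y 0 (idx 1) = 0) * (g9 R x y 0 (idx 2) = 0)
  * (g9 R x y 0 (idx 3) = 0)
  * (g9 R x y 0 (idx 4) = W 1 2 x y)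
  * (g9 R x y 0 (idx 5) = W 1 4 x y)
  * (g9 R x y 0 (idx 6) = (W 1 5 x y + W 2 3 x y)%R))%type.
Proof. bracket_coords. Qed.

Lemma g9_lie : lie_bracket (g9 R).
Proof. lie_bracket_by g9_coordE. Qed.

Lemma g9_nilpotent : nilpotent (g9 R).
Proof. nilpotent_by_table. Qed.

Lemma g19_coordE x y :
  ((g19 R x y 0 (idx 1) = 0) * (g19 R x y 0 (idx 2) = 0)
  * (g19 R x y 0 (idx 3) = 0)
  * (g19 R x y 0 (idx 4) = W 1 2 x y)
  * (g19 R x y 0 (idx 5) = W 1 4 x y)
  * (g19 R x y 0 (idx 6) = W 1 5 x y))%type.
Proof. bracket_coords. Qed.

Lemma g19_lie : lie_bracket (g19 R).
Proof. lie_bracket_by g19_coordE. Qed.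

Lemma g19_nilpotent : nilpotent (g19 R).
Proof. nilpotent_by_table. Qed.

Lemma g20_coordE x y :
  ((g20 R x y 0 (idx 1) = 0) * (g20 R x y 0 (idx 2) = 0)
  * (g20 R x y 0 (idx 3) = W 1 2 x y)
  * (g20 R x y 0 (idx 4) = W 1 3 x y)
  * (g20 R x y 0 (idx 5) = (W 1 4 x y + W 2 3 x y)%R)
  * (g20 R x y 0 (idx 6) = 0))%type.
Proof. bracket_coords. Qed.

Lemma g20_lie : lie_bracket (g20 R).
Proof. lie_bracket_by g20_coordE. Qed.

Lemma g20_nilpotent : nilpotent (g20 R).
Proof. nilpotent_by_table. Qed.

Lemma g22_coordE x y :
  ((g22 R x y 0 (idx 1) = 0) * (g22 R x y 0 (idx 2) = 0)
  * (g22 R x y 0 (idx 3) = 0)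
  * (g22 R x y 0 (idx 4) = 0)
  * (g22 R x y 0 (idx 5) = W 1 2 x y)
  * (g22 R x y 0 (idx 6) = W 1 5 x y))%type.
Proof. bracket_coords. Qed.

Lemma g22_lie : lie_bracket (g22 R).
Proof. lie_bracket_by g22_coordE. Qed.

Lemma g22_nilpotent : nilpotent (g22 R).
Proof. nilpotent_by_table. Qed.

End Algebras.

(** The vectors come in the order [x1], [x2], [v], [v'], [u], followed by the expected pairings; [z]
    is always [e 6], central in every listed algebra. *)
Ltac flag_by lie nil coordE v1 v2 v3 v4 v5 c1 c2 c3 :=
  apply: (almost_pseudo_kaehler_of_flag (x1 := v1) (x2 := v2) (v := v3)
    (v' := v4) (u := v5) (z := e _ 6) (a := c1) (b := c2) (c := c3));
  [ by rewrite dimvf /dim /= mul1n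
  | exact: lie
  | exact: nil
  | by move=> x y z; rewrite !form_coordE /wedge ?coordE /wedge; ring
  | move=> x y; apply: table_bracket_in; rewrite /= ?memvN;
    do ?[apply/andP; split]; rewrite //;
    first [ by rewrite memv_span // !inE eqxx ?orbT
          | by apply: (@memv_of_sub _ _ (e _ 4));
               rewrite memv_span // !inE eqxx ?orbT ]
  | by move=> x; apply: memv_line_e6; split;
      rewrite !coordE /wedge ?(rVD_coordE, rVN_coordE) ?e_coordE /=; ring
  | by move=> x; apply: rV6P; split; rewrite [RHS]mxE !coordE /wedge
      ?(rVD_coordE, rVN_coordE) ?e_coordE /=; ring
  | by split; rewrite !form_coordE /wedge
      ?(rVD_coordE, rVN_coordE) !e_coordE /=; ring
  | by split; rewrite !form_coordE /wedge
      ?(rVD_coordE, rVN_coordE) !e_coordE /=; ring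
  | by split; rewrite !form_coordE /wedge
      ?(rVD_coordE, rVN_coordE) !e_coordE /=; ring
  (* The final rewriting serves the value [1 - l] of [g1], nonzero because [l != 1]. *)
  | by split; rewrite ?oppr_eq0 ?mulf_neq0 ?pnatr_eq0 ?oner_eq0 //
      subr_eq0 eq_sym ].

Theorem mainTheorem1 (R : realType)
    (br : {bilinear 'rV[R]_6 -> 'rV[R]_6 -> 'rV[R]_6})
    (w : {skew_symmetric 'rV[R]_6}) :
  listed br w ->
  [/\ lie_bracket br, nilpotent br, symplectic br w
    & exists (J : 'End('rV[R]_6)) (g : {symmetric 'rV[R]_6}),
        [/\ almost_pseudo_kaehler br g J w, almost_nilpotent br J
          & indefinite_pseudo_riemannian g]].
Proof.
case.
(* The usual flag is [<e 5, e 6>] inside [<e 3, e 4, e 5, e 6>], with pairs (1,6), (2,5), (3,4). *)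
- move=> l l0 l1; flag_by g1_lie g1_nilpotent g1_coordE
    (e R 1) (e R 2) (e R 3) (e R 4) (e R 5) (1 : R) (1 - l : R) (l : R).
- move=> l l0; flag_by g2_lie g2_nilpotent g2_coordE
    (e R 1) (e R 2) (e R 3) (e R 4) (e R 5) (l : R) (- l : R) (l : R).
- flag_by g3_lie g3_nilpotent g3_coordE
    (e R 1) (e R 2) (e R 3) (e R 4) (e R 5) (1 : R) (-1 : R) (1 : R).
(* Here [w] pairs [e 3] with [e 5] and [e 2] with [e 4], so [e 4] and [e 5] exchange roles; the term
   in [l1] is absorbed by Gram-Schmidt. *)
- move=> l1 l2 l20; flag_by g4_lie g4_nilpotent g4_coordE
    (e R 1) (e R 2) (e R 3) (e R 5) (e R 4) (l2 : R) (l2 : R) (l2 : R).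
- move=> l1 l2 l20; flag_by g5_lie g5_nilpotent g5_coordE
    (e R 1) (e R 2) (e R 3) (e R 5) (e R 4) (l2 : R) (l2 : R) (l2 : R).
(* [e 2 - e 1] is orthogonal to [e 6] because [e^{16}] and [e^{26}] have the same
   coefficient, and [e 4 - e 5] spans the radical of [w] on [[g, g]] modulo
   [e 6]. *)
- move=> l l0; flag_by g5_lie g5_nilpotent g5_coordE
    (e R 1) (e R 2 - e R 1) (e R 3) (e R 4) (e R 4 - e R 5)
    (l : R) (- (4 * l) : R) (l : R).
- move=> l l0; flag_by g5_lie g5_nilpotent g5_coordE
    (e R 1) (e R 2 - e R 1) (e R 3) (e R 4) (e R 4 - e R 5)
    (l : R) (- (4 * l) : R) (l : R).
- move=> l l0; flag_by g5_lie g5_nilpotent g5_coordE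
    (e R 1) (e R 2 - e R 1) (e R 3) (e R 4) (e R 4 - e R 5)
    (l : R) (- (4 * l) : R) (l : R).
- flag_by g6_lie g6_nilpotent g6_coordE
    (e R 1) (e R 2) (e R 3) (e R 4) (e R 5) (1 : R) (1 : R) (-1 : R).
- flag_by g6_lie g6_nilpotent g6_coordE
    (e R 1) (e R 2) (e R 3) (e R 4) (e R 5) (-1 : R) (-1 : R) (1 : R).
(* For this form [e 6] pairs with [e 2] and [e 3] with [e 1], so the smaller ideal is [<e 3, e 6>];
   the same flag serves [g9] and [g19]. *)
- move=> l l0; flag_by g7_lie g7_nilpotent g7_coordE
    (e R 2) (e R 1) (e R 4) (e R 5) (e R 3) (l : R) (l : R) (- l : R).
- move=> l l0; flag_by g7_lie g7_nilpotent g7_coordE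
    (e R 1) (e R 2) (e R 3) (e R 4) (e R 5) (l : R) (l : R) (- l : R).
- flag_by g8_lie g8_nilpotent g8_coordE
    (e R 1) (e R 2) (e R 3) (e R 4) (e R 5) (1 : R) (1 : R) (-1 : R).
- move=> l l0; flag_by g9_lie g9_nilpotent g9_coordE
    (e R 2) (e R 1) (e R 4) (e R 5) (e R 3) (l : R) (l : R) (- l : R).
- flag_by g19_lie g19_nilpotent g19_coordE
    (e R 2) (e R 1) (e R 4) (e R 5) (e R 3) (1 : R) (1 : R) (-1 : R).
- flag_by g20_lie g20_nilpotent g20_coordE
    (e R 1) (e R 2) (e R 3) (e R 4) (e R 5) (1 : R) (1 : R) (-1 : R).
- flag_by g22_lie g22_nilpotent g22_coordE
    (e R 1) (e R 2) (e R 3) (e R 4) (e R 5) (1 : R) (1 : R) (1 : R).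
Qed.
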